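(* For all $b_1,b_2,b_3,c_1,c_2,c_3\in\mathbb C$ and all $q,z,w\in\mathbb C$, $$\mathcal R(z;b_1,c_1)_{12}\,\mathcal R(zw;b_2,c_2)_{13}\,\mathcal R(w;b_3,c_3)_{23}=\mathcal R(w;b_3,c_3)_{23}\,\mathcal R(zw;b_2,c_2)_{13}\,\mathcal R(z;b_1,c_1)_{12}.$$
   Context: Fix $q\in\mathbb C$. For $z,b,c\in\mathbb C$, $\mathcal R(z;b,c)$ is the following $16\times16$ complex matrix, regarded as an operator on $\mathbb C^4\otimes\mathbb C^4$ with the standard Kronecker indexing (the basis vector $v_i\otimes v_j$ has index $4(i-1)+j$). Put $$d=(q^2z-1)(q^2z+1),\quad \beta=q(q^2z^2b-q^2zc+zc-b),\quad \gamma=q(q^2z^2c-q^2zb-c+zb),$$ $$p=(q^2-1)(q^2zc+b),\quad r=(q^2-1)(q^2zb+c).$$ With $\hat E_{s,t}$ the $16\times16$ matrix units, $$\begin{aligned}\mathcal R(z;b,c)=\ & d b\,\hat E_{1,1}-d c\,\hat E_{1,6}-d b\,\hat E_{2,2}+d c\,\hat E_{2,5}+\beta\hat E_{3,3}-\gamma\hat E_{3,8}+p\hat E_{3,9}+r\hat E_{3,14}\\ &-\beta\hat E_{4,4}+\gamma\hat E_{4,7}+p\hat E_{4,10}+r\hat E_{4,13}+d c\,\hat E_{5,2}-d b\,\hat E_{5,5}-d c\,\hat E_{6,1}+d b\,\hat E_{6,6}\\ &-\gamma\hat E_{7,4}+\beta\hat E_{7,7}+r\hat E_{7,10}+p\hat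 E_{7,13}+\gamma\hat E_{8,3}-\beta\hat E_{8,8}+r\hat E_{8,9}+p\hat E_{8,14}\\ &+zr\hat E_{9,3}-zp\hat E_{9,8}+\beta\hat E_{9,9}+\gamma\hat E_{9,14}-zr\hat E_{10,4}+zp\hat E_{10,7}+\beta\hat E_{10,10}+\gamma\hat E_{10,13}\\ &+d b\,\hat E_{11,11}+d c\,\hat E_{11,16}+d b\,\hat E_{12,12}+d c\,\hat E_{12,15}\\ &+zp\hat E_{13,4}-zr\hat E_{13,7}-\gamma\hat E_{13,10}-\beta\hat E_{13,13}-zp\hat E_{14,3}+zr\hat E_{14,8}-\gamma\hat E_{14,9}-\beta\hat E_{14,14}\\ &+d c\,\hat E_{15,12}+d b\,\hat E_{15,15}+d c\,\hat E_{16,11}+d b\,\hat E_{16,16}.\end{aligned}$$ For $M=\sum_tm_t\otimes m'_t$ on $V\otimes V$ ($V=\mathbb C^4$), $M_{12}=\sum m_t\otimes m_t'\otimes\mathrm{id}$, $M_{13}=\sum m_t\otimes\mathrm{id}\otimes m'_t$, $M_{23}=\sum\mathrm{id}\otimes m_t\otimes m'_t$ on $V^{\otimes3}$. *)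

(* Defs.v *)
From HB Require Import structures.
From mathcomp Require Import all_boot all_order all_algebra.
From mathcomp Require Import reals.
From mathcomp.real_closed Require Export complex mxtens.

Set Implicit Arguments.
Unset Strict Implicit.
Unset Printing Implicit Defensive.
Import Order.TTheory GRing.Theory Num.Theory.
Local Open Scope ring_scope.

Section Legs.
Variable K : comPzRingType.

(* The linear map on matrices over K^n (x) K^n sending m (x) m' to f m m', for
   a bilinear f, computed on the basis delta_mx i j *t delta_mx k l.  Here
   mxtens_index (i, k) = i * n + k is the Kronecker index of v_i (x) v_k. *)
Definition tens_lift n N (f : 'M[K]_n -> 'M[K]_n -> 'M[K]_N)
    (M : 'M[K]_(n * n)) : 'M[K]_N :=
  \sum_(i < n) \sum_(j < n) \sum_(k < n) \sum_(l < n)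
    M (mxtens_index (i, k)) (mxtens_index (j, l))
      *: f (delta_mx i j) (delta_mx k l).

Definition leg12 n : 'M[K]_(n * n) -> 'M[K]_(n * n * n) :=
  tens_lift (fun m m' => m *t m' *t 1%:M).
Definition leg13 n : 'M[K]_(n * n) -> 'M[K]_(n * n * n) :=
  tens_lift (fun m m' => m *t 1%:M *t m').
Definition leg23 n : 'M[K]_(n * n) -> 'M[K]_(n * n * n) :=
  tens_lift (fun m m' => 1%:M *t m *t m').

Lemma tens_lift_entry n N (f : 'M[K]_n -> 'M[K]_n -> 'M[K]_N) M x y i j k l a :
  (forall m m', f m m' x y = m i j * m' k l * a) ->
  tens_lift f M x y = M (mxtens_index (i, k)) (mxtens_index (j, l)) * a.
Proof.
move=> fE; rewrite /tens_lift summxE (bigD1 i) //= summxE (bigD1 j) //=.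
rewrite summxE (bigD1 k) //= summxE (bigD1 l) //=.
rewrite !big1 ?addr0 => [|i' ne|j' ne|k' ne|l' ne].
- by rewrite mxE fE !mxE !eqxx !mul1r.
- rewrite summxE big1 // => j' _; rewrite summxE big1 // => k' _.
  rewrite summxE big1 // => l' _.
  by rewrite mxE fE !mxE [i == i']eq_sym (negPf ne) !mul0r mulr0.
- rewrite summxE big1 // => k' _; rewrite summxE big1 // => l' _.
  by rewrite mxE fE !mxE [j == j']eq_sym (negPf ne) andbF !mul0r mulr0.
- rewrite summxE big1 // => l' _.
  by rewrite mxE fE !mxE [k == k']eq_sym (negPf ne) mulr0 mul0r mulr0.
- by rewrite mxE fE !mxE [l == l']eq_sym (negPf ne) andbF mulr0 mul0r mulr0.
Qed.

Lemma leg12E n (M : 'M[K]_(n * n)) x1 x2 x3 y1 y2 y3 :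
  leg12 M (mxtens_index (mxtens_index (x1, x2), x3))
    (mxtens_index (mxtens_index (y1, y2), y3)) =
  M (mxtens_index (x1, x2)) (mxtens_index (y1, y2)) * (x3 == y3)%:R.
Proof.
by apply: tens_lift_entry => m m'; rewrite !tensmxE mxE.
Qed.

Lemma leg12_sum n I (s : seq I) (m m' : I -> 'M[K]_n) :
  leg12 (\sum_(t <- s) m t *t m' t) = \sum_(t <- s) m t *t m' t *t 1%:M.
Proof.
apply/matrixP => x y.
case: (mxtens_indexP x) => xy x3; case: (mxtens_indexP xy) => x1 x2.
case: (mxtens_indexP y) => yy y3; case: (mxtens_indexP yy) => y1 y2.
rewrite leg12E !summxE mulr_suml; apply: eq_bigr => t _.
by rewrite !tensmxE mxE.
Qed.

Lemma leg13E n (M : 'M[K]_(n * n)) x1 x2 x3 y1 y2 y3 :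
  leg13 M (mxtens_index (mxtens_index (x1, x2), x3))
    (mxtens_index (mxtens_index (y1, y2), y3)) =
  M (mxtens_index (x1, x3)) (mxtens_index (y1, y3)) * (x2 == y2)%:R.
Proof.
by apply: tens_lift_entry => m m'; rewrite !tensmxE mxE mulrAC.
Qed.

Lemma leg13_sum n I (s : seq I) (m m' : I -> 'M[K]_n) :
  leg13 (\sum_(t <- s) m t *t m' t) = \sum_(t <- s) m t *t 1%:M *t m' t.
Proof.
apply/matrixP => x y.
case: (mxtens_indexP x) => xy x3; case: (mxtens_indexP xy) => x1 x2.
case: (mxtens_indexP y) => yy y3; case: (mxtens_indexP yy) => y1 y2.
rewrite leg13E !summxE mulr_suml; apply: eq_bigr => t _.
by rewrite !tensmxE mxE mulrAC.
Qed.

Lemma leg23E n (M : 'M[K]_(n * n)) x1 x2 x3 y1 y2 y3 :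
  leg23 M (mxtens_index (mxtens_index (x1, x2), x3))
    (mxtens_index (mxtens_index (y1, y2), y3)) =
  M (mxtens_index (x2, x3)) (mxtens_index (y2, y3)) * (x1 == y1)%:R.
Proof.
by apply: tens_lift_entry => m m'; rewrite !tensmxE mxE -mulrA mulrC.
Qed.

Lemma leg23_sum n I (s : seq I) (m m' : I -> 'M[K]_n) :
  leg23 (\sum_(t <- s) m t *t m' t) = \sum_(t <- s) 1%:M *t m t *t m' t.
Proof.
apply/matrixP => x y.
case: (mxtens_indexP x) => xy x3; case: (mxtens_indexP xy) => x1 x2.
case: (mxtens_indexP y) => yy y3; case: (mxtens_indexP yy) => y1 y2.
rewrite leg23E !summxE mulr_suml; apply: eq_bigr => t _.
by rewrite !tensmxE mxE mulrC mulrA.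
Qed.

End Legs.

Section RMatrix.
Variable K : comPzRingType.

(* Matrix unit with 1-based indices: v_i (x) v_j (1 <= i, j <= 4) has index
   4 (i - 1) + j. *)
Definition unit_mx1 (s t : nat) : 'M[K]_(4 * 4) :=
  \matrix_(i, j) ((i.+1 == s) && (j.+1 == t))%:R.

Local Notation E := unit_mx1.

Definition Rmx (q z b c : K) : 'M[K]_(4 * 4) :=
  let d := (q ^+ 2 * z - 1) * (q ^+ 2 * z + 1) in
  let beta := q * (q ^+ 2 * z ^+ 2 * b - q ^+ 2 * z * c + z * c - b) in
  let gamma := q * (q ^+ 2 * z ^+ 2 * c - q ^+ 2 * z * b - c + z * b) in
  let p := (q ^+ 2 - 1) * (q ^+ 2 * z * c + b) in
  let r := (q ^+ 2 - 1) * (q ^+ 2 * z * b + c) in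
  (d * b) *: E 1 1 - (d * c) *: E 1 6 - (d * b) *: E 2 2 + (d * c) *: E 2 5
  + beta *: E 3 3 - gamma *: E 3 8 + p *: E 3 9 + r *: E 3 14
  - beta *: E 4 4 + gamma *: E 4 7 + p *: E 4 10 + r *: E 4 13
  + (d * c) *: E 5 2 - (d * b) *: E 5 5 - (d * c) *: E 6 1 + (d * b) *: E 6 6
  - gamma *: E 7 4 + beta *: E 7 7 + r *: E 7 10 + p *: E 7 13
  + gamma *: E 8 3 - beta *: E 8 8 + r *: E 8 9 + p *: E 8 14
  + (z * r) *: E 9 3 - (z * p) *: E 9 8 + beta *: E 9 9 + gamma *: E 9 14
  - (z * r) *: E 10 4 + (z * p) *: E 10 7 + beta *: E 10 10 + gamma *: E 10 13
  + (d * b) *: E 11 11 + (d * c) *: E 11 16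
  + (d * b) *: E 12 12 + (d * c) *: E 12 15
  + (z * p) *: E 13 4 - (z * r) *: E 13 7 - gamma *: E 13 10 - beta *: E 13 13
  - (z * p) *: E 14 3 + (z * r) *: E 14 8 - gamma *: E 14 9 - beta *: E 14 14
  + (d * c) *: E 15 12 + (d * b) *: E 15 15
  + (d * c) *: E 16 11 + (d * b) *: E 16 16.

End RMatrix.

(* Main.v *)
Require Import Defs.
From mathcomp Require Import all_boot all_order all_algebra.
From mathcomp Require Import reals.
From mathcomp.real_closed Require Import complex mxtens.
From mathcomp Require Import ring.

Set Implicit Arguments.
Unset Strict Implicit.
Unset Printing Implicit Defensive.
Import Order.TTheory GRing.Theory Num.Theory.
Local Open Scope ring_scope.

(** Split C^4 = C^2 (x) C^2, so that v_1, v_2, v_3, v_4 are indexed by the pairs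
    (0,0), (0,1), (1,0), (1,1) of a level and a colour.  On colours let X swap
    the two basis vectors and let Z be the sign of the second one.  The matrix
    R(z;b,c) is then the six-vertex R-matrix on levels, disguised three times.

    Twist.  Let F be the diagonal operator that applies Z to the second colour
    when the first level is 0; its diagonal entries are the values of [bichar].
    Then R = F_21 R' F_12 ([Rmx_twist]), where R' preserves the total level
    and the total colour modulo 2.  A Drinfeld twist of this kind preserves the
    Yang-Baxter equation: in each of the two triple products, the signs at the
    intermediate states can be moved to the outer states by conservation, and
    they give the same factor for both products ([yang_baxter_twist]).

    Fourier transform on colours.  R' acts on colours only through 1 and X (x) X,
    so the Hadamard matrix, which diagonalises X with eigenvalues e = +1, -1, turns
    it into a matrix that preserves every colour ([hadamard_conv]).  A change of
    basis of V preserves the Yang-Baxter equation ([yang_baxter_intertwine]), and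
    for such a colour-preserving matrix the equation splits into one equation on
    levels for each colouring e_1, e_2, e_3 ([yang_baxter_colour]).

    Sign of the spectral parameter.  On the eigenspace e = e_1 e_2 the level matrix
    is e (b + e c)(q^2 z + e) S(e z), where S is the six-vertex matrix
    ([level_mx_fourier]).  The parameters b and c occur only in the scalar factor,
    which is why they are free in each of the three legs.  As
    (e_1 e_2 z)(e_2 e_3 w) = e_1 e_3 z w, the signs are compatible with the
    spectral parameters, and what remains is the Yang-Baxter equation of the
    six-vertex model ([six_vertex_yang_baxter]). *)

(** * The Yang-Baxter equation in coordinates *)

Section YangBaxter.
Variable K : comPzRingType.

Definition yang_baxter n (A B C : 'M[K]_(n * n)) :=
  leg12 A *m leg13 B *m leg23 C = leg23 C *m leg13 B *m leg12 A.

Definition entry2 n (A : 'M[K]_(n * n)) (x1 x2 y1 y2 : 'I_n) :=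
  A (mxtens_index (x1, x2)) (mxtens_index (y1, y2)).

Lemma sum_mxtens m n (F : 'I_(m * n) -> K) :
  \sum_x F x = \sum_i \sum_j F (mxtens_index (i, j)).
Proof.
rewrite pair_big /=; apply: reindex; exists (@mxtens_unindex m n) => x _.
  by case: x => i j; rewrite mxtens_indexK.
by rewrite -surjective_pairing mxtens_unindexK.
Qed.

(** Used when conservation of colour leaves a single admissible colour. *)
Lemma sum_mxtens_colour m n (F : 'I_(m * n) -> K) e :
  (forall i e', e != e' -> F (mxtens_index (i, e')) = 0) ->
  \sum_x F x = \sum_i F (mxtens_index (i, e)).
Proof.
move=> F0; rewrite sum_mxtens; apply: eq_bigr => i _.
by rewrite (bigD1 e) //= big1 ?addr0 // => e' ne; rewrite F0 // eq_sym.
Qed.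

Lemma matrix2P n (A B : 'M[K]_(n * n)) :
  (forall x1 x2 y1 y2, entry2 A x1 x2 y1 y2 = entry2 B x1 x2 y1 y2) -> A = B.
Proof.
move=> AB; apply/matrixP => x y.
by case: (mxtens_indexP x) => x1 x2; case: (mxtens_indexP y) => y1 y2; apply: AB.
Qed.

Lemma sum_deltal n (F : 'I_n -> K) i : \sum_j (i == j)%:R * F j = F i.
Proof.
by rewrite (bigD1 i) //= eqxx mul1r big1 ?addr0 // => j /negPf;
   rewrite eq_sym => ->; rewrite mul0r.
Qed.

Lemma sum_deltar n (F : 'I_n -> K) i : \sum_j (j == i)%:R * F j = F i.
Proof. by rewrite -[RHS]sum_deltal; apply: eq_bigr => j _; rewrite eq_sym. Qed.

Local Notation tri x1 x2 x3 := (mxtens_index (mxtens_index (x1, x2), x3)).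

Lemma leg12_mulE n (A : 'M[K]_(n * n)) (M : 'M[K]_(n * n * n)) x1 x2 x3 y :
  (leg12 A *m M) (tri x1 x2 x3) y =
  \sum_i \sum_j entry2 A x1 x2 i j * M (tri i j x3) y.
Proof.
rewrite mxE !sum_mxtens; apply: eq_bigr => i _; apply: eq_bigr => j _.
rewrite -(sum_deltal (fun k => _ * M (tri i j k) y)).
by apply: eq_bigr => k _; rewrite leg12E /entry2; ring.
Qed.

Lemma leg13_mulE n (A : 'M[K]_(n * n)) (M : 'M[K]_(n * n * n)) x1 x2 x3 y :
  (leg13 A *m M) (tri x1 x2 x3) y =
  \sum_i \sum_k entry2 A x1 x3 i k * M (tri i x2 k) y.
Proof.
rewrite mxE !sum_mxtens; apply: eq_bigr => i _.
rewrite exchange_big; apply: eq_bigr => k _.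
rewrite -(sum_deltal (fun j => _ * M (tri i j k) y)).
by apply: eq_bigr => j _; rewrite leg13E /entry2; ring.
Qed.

Lemma leg23_mulE n (A : 'M[K]_(n * n)) (M : 'M[K]_(n * n * n)) x1 x2 x3 y :
  (leg23 A *m M) (tri x1 x2 x3) y =
  \sum_j \sum_k entry2 A x2 x3 j k * M (tri x1 j k) y.
Proof.
rewrite mxE !sum_mxtens exchange_big; apply: eq_bigr => j _.
rewrite exchange_big; apply: eq_bigr => k _.
rewrite -(sum_deltal (fun i => _ * M (tri i j k) y)).
by apply: eq_bigr => i _; rewrite leg23E /entry2; ring.
Qed.

(** Each leg fixes one tensor factor, so the states between two legs are (i, j, x3)
    and (y1, j, k): the sum is over the three internal lines of a triangle. *)
Lemma leg_prodl n (A B C : 'M[K]_(n * n)) x1 x2 x3 y1 y2 y3 :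
  (leg12 A *m leg13 B *m leg23 C) (tri x1 x2 x3) (tri y1 y2 y3) =
  \sum_i \sum_j \sum_k
     entry2 A x1 x2 i j * entry2 B i x3 y1 k * entry2 C j k y2 y3.
Proof.
rewrite -mulmxA leg12_mulE; apply: eq_bigr => i _; apply: eq_bigr => j _.
rewrite leg13_mulE exchange_big mulr_sumr; apply: eq_bigr => k _.
rewrite -(sum_deltar (fun i' => _ * entry2 B i x3 i' k * _)) mulr_sumr.
apply: eq_bigr => i' _; rewrite leg23E -/(entry2 C j k y2 y3).
by ring.
Qed.

Lemma leg_prodr n (A B C : 'M[K]_(n * n)) x1 x2 x3 y1 y2 y3 :
  (leg23 C *m leg13 B *m leg12 A) (tri x1 x2 x3) (tri y1 y2 y3) =
  \sum_i \sum_j \sum_k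
     entry2 C x2 x3 j k * entry2 B x1 k i y3 * entry2 A i j y1 y2.
Proof.
rewrite -mulmxA leg23_mulE [RHS]exchange_big; apply: eq_bigr => j _.
rewrite [RHS]exchange_big; apply: eq_bigr => k _.
rewrite leg13_mulE mulr_sumr; apply: eq_bigr => i _.
rewrite -(sum_deltar (fun k' => _ * entry2 B x1 k i k' * _)) mulr_sumr.
apply: eq_bigr => k' _; rewrite leg12E -/(entry2 A i j y1 y2).
by ring.
Qed.

Lemma yang_baxterP n (A B C : 'M[K]_(n * n)) :
  yang_baxter A B C <->
  forall x1 x2 x3 y1 y2 y3,
    \sum_i \sum_j \sum_k
      entry2 A x1 x2 i j * entry2 B i x3 y1 k * entry2 C j k y2 y3 =
    \sum_i \sum_j \sum_k
      entry2 C x2 x3 j k * entry2 B x1 k i y3 * entry2 A i j y1 y2.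
Proof.
split=> [YB x1 x2 x3 y1 y2 y3 | YB].
  by rewrite -leg_prodl -leg_prodr YB.
apply/matrixP => x y.
case: (mxtens_indexP x) => x12 x3; case: (mxtens_indexP x12) => x1 x2.
case: (mxtens_indexP y) => y12 y3; case: (mxtens_indexP y12) => y1 y2.
by rewrite leg_prodl leg_prodr.
Qed.

Lemma entry2_scale n a (A : 'M[K]_(n * n)) x1 x2 y1 y2 :
  entry2 (a *: A) x1 x2 y1 y2 = a * entry2 A x1 x2 y1 y2.
Proof. by rewrite /entry2 mxE. Qed.

Lemma yang_baxter_scale n a b c (A B C : 'M[K]_(n * n)) :
  yang_baxter A B C -> yang_baxter (a *: A) (b *: B) (c *: C).
Proof.
move=> /yang_baxterP YB; apply/yang_baxterP => x1 x2 x3 y1 y2 y3.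
transitivity (a * b * c * \sum_i \sum_j \sum_k
      entry2 A x1 x2 i j * entry2 B i x3 y1 k * entry2 C j k y2 y3).
  rewrite mulr_sumr; apply: eq_bigr => i _; rewrite mulr_sumr.
  apply: eq_bigr => j _; rewrite mulr_sumr; apply: eq_bigr => k _.
  rewrite !entry2_scale; ring.
rewrite YB mulr_sumr; apply: eq_bigr => i _; rewrite mulr_sumr.
apply: eq_bigr => j _; rewrite mulr_sumr; apply: eq_bigr => k _.
rewrite !entry2_scale; ring.
Qed.

(** This is F_21 A F_12 for the diagonal operator F with entry f x y at the basis
    vector v_x (x) v_y; hence the exchanged arguments on the row side. *)
Definition twist n (f : 'I_n -> 'I_n -> K) (A : 'M[K]_(n * n)) : 'M[K]_(n * n) :=
  \matrix_(x, y) (f (mxtens_unindex x).2 (mxtens_unindex x).1 * A x y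
                  * f (mxtens_unindex y).1 (mxtens_unindex y).2).

Lemma twist_entry2 n f (A : 'M[K]_(n * n)) x1 x2 y1 y2 :
  entry2 (twist f A) x1 x2 y1 y2 = f x2 x1 * entry2 A x1 x2 y1 y2 * f y1 y2.
Proof. by rewrite /entry2 mxE !mxtens_indexK. Qed.

(** Additive conservation laws in exponential form: the entries of A vanish
    unless the two charges read off by f, one through each argument of f, have
    the same total before and after scattering. *)
Definition conserves n (f : 'I_n -> 'I_n -> K) (A : 'M[K]_(n * n)) :=
  forall x1 x2 y1 y2, entry2 A x1 x2 y1 y2 != 0 -> forall t,
    f x1 t * f x2 t = f y1 t * f y2 t /\ f t x1 * f t x2 = f t y1 * f t y2.

(** In each triple product the factors of f that involve an internal line are
    eliminated with the conservation laws of A, B and C.  The same product g of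
    values of f at the outer lines comes out on both sides. *)
Lemma yang_baxter_twist n (f : 'I_n -> 'I_n -> K) (A B C : 'M[K]_(n * n)) :
  (forall x y, f x y * f x y = 1) ->
  conserves f A -> conserves f B -> conserves f C ->
  yang_baxter A B C -> yang_baxter (twist f A) (twist f B) (twist f C).
Proof.
move=> ff fA fB fC /yang_baxterP YB; apply/yang_baxterP => x1 x2 x3 y1 y2 y3.
have swap (a d u v : K) : u * u = 1 -> d * d = 1 -> a * u = v * d -> a * d = u * v.
  move=> uu dd e; transitivity (a * u * (d * u)); first by ring: uu.
  by rewrite e; ring: dd.
pose g := f x2 x1 * f x3 x1 * f x3 x2 * f y1 y2 * f y1 y3 * f y2 y3.
transitivity (g * \sum_i \sum_j \sum_k
      entry2 A x1 x2 i j * entry2 B i x3 y1 k * entry2 C j k y2 y3).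
  rewrite mulr_sumr; apply: eq_bigr => i _; rewrite mulr_sumr.
  apply: eq_bigr => j _; rewrite mulr_sumr; apply: eq_bigr => k _.
  rewrite !twist_entry2.
  have [->|nA] := eqVneq (entry2 A x1 x2 i j) 0; first by ring.
  have [->|nB] := eqVneq (entry2 B i x3 y1 k) 0; first by ring.
  have [->|nC] := eqVneq (entry2 C j k y2 y3) 0; first by ring.
  have [_ eA] := fA _ _ _ _ nA x3; have [eB _] := fB _ _ _ _ nB j.
  have [_ eC] := fC _ _ _ _ nC y1.
  (* This form of the conservation law at B removes the two factors that involve j. *)
  have {}eB := swap _ _ _ _ (ff _ _) (ff _ _) eB.
  have e : f i j * f x3 i * f y1 k * f k j
           = f x3 x1 * f x3 x2 * (f y1 y2 * f y1 y3).
    by rewrite eA -eC; ring: eB.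
  by rewrite /g; ring: e.
rewrite YB mulr_sumr; apply: eq_bigr => i _; rewrite mulr_sumr.
apply: eq_bigr => j _; rewrite mulr_sumr; apply: eq_bigr => k _.
rewrite !twist_entry2.
have [->|nA] := eqVneq (entry2 A i j y1 y2) 0; first by ring.
have [->|nB] := eqVneq (entry2 B x1 k i y3) 0; first by ring.
have [->|nC] := eqVneq (entry2 C x2 x3 j k) 0; first by ring.
have [eA _] := fA _ _ _ _ nA y3; have [_ eB] := fB _ _ _ _ nB j.
have [eC _] := fC _ _ _ _ nC x1.
have {}eB := swap _ _ _ _ (ff _ _) (ff _ _) (esym eB).
have e : f j k * f k x1 * f i y3 * f j i
         = f x2 x1 * f x3 x1 * (f y1 y3 * f y2 y3).
  by rewrite eC -eA; ring: eB.
by rewrite /g; ring: e.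
Qed.

Definition colour_diag m n (S : 'I_n -> 'I_n -> 'M[K]_(m * m)) :
    'M[K]_((m * n) * (m * n)) :=
  \matrix_(x, y)
    let x1 := mxtens_unindex (mxtens_unindex x).1 in
    let x2 := mxtens_unindex (mxtens_unindex x).2 in
    let y1 := mxtens_unindex (mxtens_unindex y).1 in
    let y2 := mxtens_unindex (mxtens_unindex y).2 in
    (x1.2 == y1.2)%:R * (x2.2 == y2.2)%:R
    * entry2 (S x1.2 x2.2) x1.1 x2.1 y1.1 y2.1.

Lemma colour_diagE m n (S : 'I_n -> 'I_n -> 'M[K]_(m * m)) l1 e1 l2 e2 m1 f1 m2 f2 :
  entry2 (colour_diag S) (mxtens_index (l1, e1)) (mxtens_index (l2, e2))
    (mxtens_index (m1, f1)) (mxtens_index (m2, f2))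
  = (e1 == f1)%:R * (e2 == f2)%:R * entry2 (S e1 e2) l1 l2 m1 m2.
Proof. by rewrite /entry2 mxE !mxtens_indexK. Qed.

(** Colours pass unchanged along each of the three lines, so e1, e2, e3 fix the
    colours of all internal lines and the sums run over levels only. *)
Lemma yang_baxter_colour m n (S1 S2 S3 : 'I_n -> 'I_n -> 'M[K]_(m * m)) :
  (forall e1 e2 e3, yang_baxter (S1 e1 e2) (S2 e1 e3) (S3 e2 e3)) ->
  yang_baxter (colour_diag S1) (colour_diag S2) (colour_diag S3).
Proof.
move=> YB; apply/yang_baxterP => x1 x2 x3 y1 y2 y3.
case: (mxtens_indexP x1) => l1 e1; case: (mxtens_indexP x2) => l2 e2.
case: (mxtens_indexP x3) => l3 e3; case: (mxtens_indexP y1) => m1 f1.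
case: (mxtens_indexP y2) => m2 f2; case: (mxtens_indexP y3) => m3 f3.
pose g := (e1 == f1)%:R * (e2 == f2)%:R * (e3 == f3)%:R : K.
transitivity (g * \sum_i \sum_j \sum_k entry2 (S1 e1 e2) l1 l2 i j
     * entry2 (S2 e1 e3) i l3 m1 k * entry2 (S3 e2 e3) j k m2 m3).
  rewrite (sum_mxtens_colour (e := e1)) => [|i e' /negPf ne]; last first.
    rewrite big1 // => j _; rewrite big1 // => k _.
    case: (mxtens_indexP j) => lj ej; case: (mxtens_indexP k) => lk ek.
    by rewrite !colour_diagE ne /=; ring.
  rewrite mulr_sumr; apply: eq_bigr => i _.
  rewrite (sum_mxtens_colour (e := e2)) => [|j e' /negPf ne]; last first.
    rewrite big1 // => k _; case: (mxtens_indexP k) => lk ek.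
    by rewrite !colour_diagE ne /=; ring.
  rewrite mulr_sumr; apply: eq_bigr => j _.
  rewrite (sum_mxtens_colour (e := e3)) => [|k e' /negPf ne]; last first.
    by rewrite !colour_diagE ne /=; ring.
  rewrite mulr_sumr; apply: eq_bigr => k _.
  by rewrite !colour_diagE !eqxx /g /=; ring.
move: (YB e1 e2 e3) => /yang_baxterP ->.
rewrite (sum_mxtens_colour (e := e1)) => [|i e' /negPf ne]; last first.
  rewrite big1 // => j _; rewrite big1 // => k _.
  case: (mxtens_indexP j) => lj ej; case: (mxtens_indexP k) => lk ek.
  by rewrite !colour_diagE ne /=; ring.
rewrite mulr_sumr; apply: eq_bigr => i _.
rewrite (sum_mxtens_colour (e := e2)) => [|j e' /negPf ne]; last first.
  rewrite big1 // => k _; case: (mxtens_indexP k) => lk ek.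
  by rewrite !colour_diagE ne /=; ring.
rewrite mulr_sumr; apply: eq_bigr => j _.
rewrite (sum_mxtens_colour (e := e3)) => [|k e' /negPf ne]; last first.
  by rewrite !colour_diagE ne /=; ring.
rewrite mulr_sumr; apply: eq_bigr => k _.
by rewrite !colour_diagE !eqxx /g /=; ring.
Qed.

(** The third copy of h acts on the factor where the leg is the identity, so it
    commutes with the leg.  The same holds for the two other legs. *)
Lemma intertwine12 n (h : 'M[K]_n) (A A' : 'M[K]_(n * n)) :
  (h *t h) *m A = A' *m (h *t h) ->
  (h *t h *t h) *m leg12 A = leg12 A' *m (h *t h *t h).
Proof.
move=> hA; apply/matrixP => x y.
case: (mxtens_indexP x) => x12 x3; case: (mxtens_indexP x12) => x1 x2.
case: (mxtens_indexP y) => y12 y3; case: (mxtens_indexP y12) => y1 y2.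
transitivity (((h *t h) *m A) (mxtens_index (x1, x2)) (mxtens_index (y1, y2)) * h x3 y3).
  rewrite !mxE !sum_mxtens mulr_suml; apply: eq_bigr => i _.
  rewrite mulr_suml; apply: eq_bigr => j _.
  rewrite -(sum_deltar (fun k => _ * h x3 k)).
  by apply: eq_bigr => k _; rewrite !tensmxE leg12E; ring.
rewrite hA leg12_mulE mxE sum_mxtens mulr_suml; apply: eq_bigr => i _.
by rewrite mulr_suml; apply: eq_bigr => j _; rewrite !tensmxE /entry2; ring.
Qed.

Lemma intertwine13 n (h : 'M[K]_n) (A A' : 'M[K]_(n * n)) :
  (h *t h) *m A = A' *m (h *t h) ->
  (h *t h *t h) *m leg13 A = leg13 A' *m (h *t h *t h).
Proof.
move=> hA; apply/matrixP => x y.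
case: (mxtens_indexP x) => x12 x3; case: (mxtens_indexP x12) => x1 x2.
case: (mxtens_indexP y) => y12 y3; case: (mxtens_indexP y12) => y1 y2.
transitivity (((h *t h) *m A) (mxtens_index (x1, x3)) (mxtens_index (y1, y3)) * h x2 y2).
  rewrite !mxE !sum_mxtens mulr_suml; apply: eq_bigr => i _.
  rewrite mulr_suml exchange_big; apply: eq_bigr => k _.
  rewrite -(sum_deltar (fun j => _ * h x2 j)).
  by apply: eq_bigr => j _; rewrite !tensmxE leg13E; ring.
rewrite hA leg13_mulE mxE sum_mxtens mulr_suml; apply: eq_bigr => i _.
by rewrite mulr_suml; apply: eq_bigr => j _; rewrite !tensmxE /entry2; ring.
Qed.

Lemma intertwine23 n (h : 'M[K]_n) (A A' : 'M[K]_(n * n)) :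
  (h *t h) *m A = A' *m (h *t h) ->
  (h *t h *t h) *m leg23 A = leg23 A' *m (h *t h *t h).
Proof.
move=> hA; apply/matrixP => x y.
case: (mxtens_indexP x) => x12 x3; case: (mxtens_indexP x12) => x1 x2.
case: (mxtens_indexP y) => y12 y3; case: (mxtens_indexP y12) => y1 y2.
transitivity (((h *t h) *m A) (mxtens_index (x2, x3)) (mxtens_index (y2, y3)) * h x1 y1).
  rewrite !mxE !sum_mxtens mulr_suml exchange_big; apply: eq_bigr => j _.
  rewrite mulr_suml exchange_big; apply: eq_bigr => k _.
  rewrite -(sum_deltar (fun i => _ * h x1 i)).
  by apply: eq_bigr => i _; rewrite !tensmxE leg23E; ring.
rewrite hA leg23_mulE mxE sum_mxtens mulr_suml; apply: eq_bigr => i _.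
by rewrite mulr_suml; apply: eq_bigr => j _; rewrite !tensmxE /entry2; ring.
Qed.

Lemma tens1mx m n : (1%:M : 'M[K]_m) *t (1%:M : 'M[K]_n) = 1%:M.
Proof.
apply/matrixP => x y.
case: (mxtens_indexP x) => i j; case: (mxtens_indexP y) => k l.
rewrite tensmxE !mxE (can_eq (@mxtens_indexK m n)) xpair_eqE.
by rewrite -natrM mulnb.
Qed.

(** The operator h (x) h (x) h carries each triple product for A, B, C to the one
    for A', B', C', and it can be cancelled since h has a left inverse. *)
Lemma yang_baxter_intertwine n (h h' : 'M[K]_n) (A B C A' B' C' : 'M[K]_(n * n)) :
  h' *m h = 1%:M ->
  (h *t h) *m A = A' *m (h *t h) ->
  (h *t h) *m B = B' *m (h *t h) ->
  (h *t h) *m C = C' *m (h *t h) ->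
  yang_baxter A' B' C' -> yang_baxter A B C.
Proof.
move=> h'h hA hB hC YB; set H := h *t h *t h; set H' := h' *t h' *t h'.
have H'H : H' *m H = 1%:M.
  by rewrite /H /H' !tensmx_mul h'h !tens1mx.
rewrite /yang_baxter -[LHS]mul1mx -[RHS]mul1mx -H'H -!(mulmxA H'); congr (H' *m _).
rewrite !mulmxA (intertwine12 hA) (intertwine23 hC).
rewrite -[_ *m H *m leg13 B]mulmxA -[leg23 C' *m H *m _]mulmxA (intertwine13 hB).
rewrite !mulmxA -[_ *m H *m leg23 C]mulmxA -[_ *m H *m leg12 A]mulmxA.
by rewrite (intertwine12 hA) (intertwine23 hC) !mulmxA YB.
Qed.

End YangBaxter.

(** Unlike a general case analysis on 'I_2, this leaves ordinals on which equality
    tests compute. *)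
Lemma ord2_ind (P : 'I_2 -> Prop) : P ord0 -> P (lift ord0 ord0) -> forall i, P i.
Proof.
move=> P0 P1 [[|[|//]] lt_i2].
  by rewrite (_ : Ordinal _ = ord0) //; apply: val_inj.
by rewrite (_ : Ordinal _ = lift ord0 ord0) //; apply: val_inj.
Qed.

(** * The six-vertex model *)

Section SixVertex.
Variable K : comPzRingType.

(** Rows and columns are 00, 01, 10, 11; c is the entry at (01, 10) and c' the one
    at (10, 01). *)
Definition six_vertex (a b c c' : K) : 'M[K]_(2 * 2) :=
  \matrix_(x, y)
    let: (l1, l2) := mxtens_unindex x in let: (m1, m2) := mxtens_unindex y in
    if l1 == l2 then if (m1 == l1) && (m2 == l2) then a else 0
    else if (m1 == l1) && (m2 == l2) then b
    else if (m1 == l2) && (m2 == l1) then if l1 == 0 then c else c'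
    else 0.

Lemma six_vertexE a b c c' l1 l2 m1 m2 :
  entry2 (six_vertex a b c c') l1 l2 m1 m2 =
    if l1 == l2 then if (m1 == l1) && (m2 == l2) then a else 0
    else if (m1 == l1) && (m2 == l2) then b
    else if (m1 == l2) && (m2 == l1) then if l1 == 0 then c else c'
    else 0.
Proof. by rewrite /entry2 mxE !mxtens_indexK. Qed.

(** The gauge in which z multiplies just one of the two exchange weights; here the
    Yang-Baxter equation has multiplicative spectral parameters. *)
Definition six_vertex_R q z :=
  six_vertex (q ^+ 2 * z - 1) (q * (z - 1)) (q ^+ 2 - 1) (z * (q ^+ 2 - 1)).

Lemma six_vertex_yang_baxter q z w :
  yang_baxter (six_vertex_R q z) (six_vertex_R q (z * w)) (six_vertex_R q w).
Proof.
apply/yang_baxterP.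
move=> x1 x2 x3 y1 y2 y3; rewrite !big_ord_recl !big_ord0 !six_vertexE.
move: x1 x2 x3 y1 y2 y3; by do 6![apply: ord2_ind] => /=; ring.
Qed.

End SixVertex.

(** * Reduction of R(z;b,c) to the six-vertex matrix *)

Section Factorisation.
Variable K : comUnitRingType.

Definition sign (e : 'I_2) : K := if e == 0 then 1 else -1.

(** The sign (-1)^(pq), where p is 1 if x has level 0 and q is the colour of y. *)
Definition bichar (x y : 'I_(2 * 2)) : K :=
  if ((mxtens_unindex x).1 == 0) && ((mxtens_unindex y).2 != 0) then -1 else 1.

(** W0 tensored with the identity on colours plus W1 tensored with X (x) X: a
    convolution operator for the group Z/2 of colours. *)
Definition colour_conv (W0 W1 : 'M[K]_(2 * 2)) : 'M[K]_((2 * 2) * (2 * 2)) :=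
  \matrix_(x, y)
    let x1 := mxtens_unindex (mxtens_unindex x).1 in
    let x2 := mxtens_unindex (mxtens_unindex x).2 in
    let y1 := mxtens_unindex (mxtens_unindex y).1 in
    let y2 := mxtens_unindex (mxtens_unindex y).2 in
    if (x1.2 == y1.2) && (x2.2 == y2.2) then entry2 W0 x1.1 x2.1 y1.1 y2.1
    else if (x1.2 != y1.2) && (x2.2 != y2.2) then entry2 W1 x1.1 x2.1 y1.1 y2.1
    else 0.

Lemma colour_convE W0 W1 l1 s1 l2 s2 m1 t1 m2 t2 :
  entry2 (colour_conv W0 W1) (mxtens_index (l1, s1)) (mxtens_index (l2, s2))
    (mxtens_index (m1, t1)) (mxtens_index (m2, t2)) =
  if (s1 == t1) && (s2 == t2) then entry2 W0 l1 l2 m1 m2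
  else if (s1 != t1) && (s2 != t2) then entry2 W1 l1 l2 m1 m2 else 0.
Proof. by rewrite /entry2 mxE !mxtens_indexK. Qed.

(** The character table of Z/2, acting on colours. *)
Definition hadamard : 'M[K]_(2 * 2) :=
  1%:M *t \matrix_(e < 2, s < 2) (if s == 0 then 1 else sign e).

Lemma hadamardE l e m s :
  hadamard (mxtens_index (l, e)) (mxtens_index (m, s)) =
  (l == m)%:R * (if s == 0 then 1 else sign e).
Proof. by rewrite /hadamard tensmxE !mxE. Qed.

Lemma hadamard_sqr : hadamard *m hadamard = 2%:R%:M.
Proof.
apply/matrixP => x y; case: (mxtens_indexP x) => l e; case: (mxtens_indexP y) => m s.
rewrite !mxE (can_eq (@mxtens_indexK 2 2)) xpair_eqE sum_mxtens.
rewrite !big_ord_recl !big_ord0 !hadamardE /sign.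
move: l e m s; do 4![apply: ord2_ind] => /=; ring.
Qed.

Lemma sum_hadamardl l e (F : 'I_(2 * 2) -> K) :
  \sum_x hadamard (mxtens_index (l, e)) x * F x =
  F (mxtens_index (l, ord0)) + sign e * F (mxtens_index (l, lift ord0 ord0)).
Proof.
rewrite sum_mxtens (bigD1 l) //= [X in _ + X]big1 => [|i /negPf ne]; last first.
  by rewrite big1 // => s _; rewrite hadamardE eq_sym ne !mul0r.
by rewrite addr0 !big_ord_recl big_ord0 !hadamardE eqxx /=; ring.
Qed.

Lemma hadamard_sym x y : hadamard x y = hadamard y x.
Proof.
case: (mxtens_indexP x) => l e; case: (mxtens_indexP y) => m s.
rewrite !hadamardE eq_sym; congr (_ * _).
by move: e s; do 2![apply: ord2_ind].
Qed.

(** On the characters e and f of Z/2, X (x) X acts by the scalar sign e * sign f. *)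
Lemma hadamard_conv W0 W1 :
  (hadamard *t hadamard) *m colour_conv W0 W1 =
  colour_diag (fun e f => W0 + sign e * sign f *: W1) *m (hadamard *t hadamard).
Proof.
apply: matrix2P => x1 x2 y1 y2.
case: (mxtens_indexP x1) => l1 e1; case: (mxtens_indexP x2) => l2 e2.
case: (mxtens_indexP y1) => m1 t1; case: (mxtens_indexP y2) => m2 t2.
rewrite /entry2 !mxE [LHS]sum_mxtens [RHS]sum_mxtens.
under eq_bigr => x _.
  under eq_bigr => y _ do rewrite tensmxE -mulrA.
  rewrite -mulr_sumr sum_hadamardl.
  over.
under [RHS]eq_bigr => x _.
  under eq_bigr => y _ do
    rewrite tensmxE [hadamard x _]hadamard_sym [hadamard y _]hadamard_sym mulrC -mulrA.
  rewrite -mulr_sumr sum_hadamardl.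
  over.
rewrite !sum_hadamardl -!/(entry2 _ _ _ _ _) !colour_convE !colour_diagE.
have addE (A B : 'M[K]_(2 * 2)) a : entry2 (A + a *: B) l1 l2 m1 m2
    = entry2 A l1 l2 m1 m2 + a * entry2 B l1 l2 m1 m2 by rewrite /entry2 !mxE.
rewrite !addE /sign; move: (entry2 W0 _ _ _ _) (entry2 W1 _ _ _ _) => a b.
by move: e1 e2 t1 t2; do 4![apply: ord2_ind] => /=; ring.
Qed.

(** Exchanging b and c in these weights gives the amplitudes of the transitions
    in which both colours flip: it sends beta to gamma and exchanges p and r. *)
Definition level_mx (q z b c : K) :=
  let d := (q ^+ 2 * z - 1) * (q ^+ 2 * z + 1) in
  let beta := q * (q ^+ 2 * z ^+ 2 * b - q ^+ 2 * z * c + z * c - b) in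
  let p := (q ^+ 2 - 1) * (q ^+ 2 * z * c + b) in
  let r := (q ^+ 2 - 1) * (q ^+ 2 * z * b + c) in
  six_vertex (d * b) beta p (z * r).

Definition untwisted q z b c := colour_conv (level_mx q z b c) (level_mx q z c b).

(** The signs in the table of R(z;b,c) are those of the twist: in the sector of two
    levels 0, for instance, R acts as d (Z (x) Z)(b - c X (x) X), which equals
    d (Z (x) 1)(b + c X (x) X)(1 (x) Z) because X and Z anticommute. *)
Lemma Rmx_twist q z b c : Rmx q z b c = twist bichar (untwisted q z b c).
Proof.
rewrite /untwisted /Rmx /level_mx.
have -> : q * (q ^+ 2 * z ^+ 2 * c - q ^+ 2 * z * b + z * b - c) =
          q * (q ^+ 2 * z ^+ 2 * c - q ^+ 2 * z * b - c + z * b) by ring.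
cbv zeta; move: ((q ^+ 2 - 1) * (_ * c + b)) ((q ^+ 2 - 1) * (_ * b + c)) => p r.
move: (z * p) (z * r) (q * (_ - b)) (q * (_ - _ + z * b)) => zp zr beta gamma.
move: (_ * b) (_ * c) => db dc.
apply: (@matrix2P _ (2 * 2)) => x1 x2 y1 y2; rewrite twist_entry2.
case: (mxtens_indexP x1) => l1 e1; case: (mxtens_indexP x2) => l2 e2.
case: (mxtens_indexP y1) => m1 t1; case: (mxtens_indexP y2) => m2 t2.
rewrite colour_convE !six_vertexE /bichar !mxtens_indexK /entry2.
rewrite !mxE.
move: l1 e1 l2 e2 m1 t1 m2 t2.
by do 8![apply: ord2_ind] => /=; ring.
Qed.

(** Each six-vertex weight of b and c has its b + c and b - c components divisible
    by q^2 z + 1 and q^2 z - 1 respectively; for instance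
    (q^2 z - 1)(q^2 z + 1) = (q^2 z + e) e (q^2 (e z) - 1) when e^2 = 1. *)
Lemma level_mx_fourier e q z b c : e * e = 1 ->
  level_mx q z b c + e *: level_mx q z c b =
  (e * (b + e * c) * (q ^+ 2 * z + e)) *: six_vertex_R q (e * z).
Proof.
move=> ee; apply: matrix2P => l1 l2 m1 m2.
rewrite /entry2 !mxE -!/(entry2 _ _ _ _ _) !mxtens_indexK.
move: l1 l2 m1 m2; do 4![apply: ord2_ind] => /=; ring: ee.
Qed.

(** The first argument of [bichar] reads the level, whose total is conserved by W0
    and W1; the second one reads the colour, and a convolution operator flips
    both colours or neither. *)
Lemma colour_conv_conserves W0 W1 : 
  (forall l1 l2 m1 m2, entry2 W0 l1 l2 m1 m2 != 0 \/ entry2 W1 l1 l2 m1 m2 != 0 -> (l1 + l2 = m1 + m2)%N) ->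
  conserves bichar (colour_conv W0 W1).
Proof.
move=> W01 x1 x2 y1 y2.
case: (mxtens_indexP x1) => l1 e1; case: (mxtens_indexP x2) => l2 e2.
case: (mxtens_indexP y1) => m1 t1; case: (mxtens_indexP y2) => m2 t2.
rewrite colour_convE => nz t; case: (mxtens_indexP t) => l s.
rewrite /bichar !mxtens_indexK /=.
have {W01} ll : (l1 + l2 = m1 + m2)%N.
  apply: W01; move: nz; case: ifP => _ nz; first by left.
  by move: nz; case: ifP => _ nz; [right | rewrite eqxx in nz].
have {nz} ee : (e1 == t1) = (e2 == t2).
  by move: nz; case: (e1 == t1); case: (e2 == t2); rewrite //= eqxx.
split.
  move: l1 l2 m1 m2 ll; do 4![apply: ord2_ind] => //= _; case: (s != 0) => /=; ring.
by move: e1 t1 e2 t2 ee; do 4![apply: ord2_ind] => //= _; case: (l == 0) => /=; ring.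
Qed.

Lemma six_vertex_conserves a b c c' l1 l2 m1 m2 :
  entry2 (six_vertex a b c c' : 'M[K]_(2 * 2)) l1 l2 m1 m2 != 0 -> (l1 + l2 = m1 + m2)%N.
Proof.
rewrite six_vertexE; move: l1 l2 m1 m2.
by do 4![apply: ord2_ind]; rewrite //= eqxx.
Qed.

Lemma Rmx_yang_baxter (b1 b2 b3 c1 c2 c3 q z w : K) : (2%:R : K) \is a GRing.unit ->
  yang_baxter (Rmx q z b1 c1) (Rmx q (z * w) b2 c2) (Rmx q w b3 c3).
Proof.
move=> u2; rewrite !Rmx_twist.
have cons x b c : conserves bichar (untwisted q x b c).
  by apply: colour_conv_conserves => l1 l2 m1 m2 [] /six_vertex_conserves.
apply: yang_baxter_twist => //.
  by move=> x y; rewrite /bichar; case: ifP => _; ring.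
apply: (@yang_baxter_intertwine _ _ hadamard (2%:R^-1 *: hadamard));
  [|exact: hadamard_conv..|].
  by rewrite -scalemxAl hadamard_sqr scale_scalar_mx mulVr.
apply: yang_baxter_colour => e1 e2 e3.
have ss e : sign e * sign e = 1 by rewrite /sign; case: ifP => _; ring.
rewrite !level_mx_fourier; try by rewrite mulrACA !ss mulr1.
apply: yang_baxter_scale.
(* The sign of e2 occurs twice, so the three spectral parameters still multiply. *)
have -> : sign e1 * sign e3 * (z * w) = (sign e1 * sign e2 * z) * (sign e2 * sign e3 * w).
  by move: (ss e2) => s2; ring: s2.
exact: six_vertex_yang_baxter.
Qed.

End Factorisation.

Theorem theorem6p2 (R : realType) (b1 b2 b3 c1 c2 c3 q z w : R[i]) :
  leg12 (Rmx q z b1 c1) *m leg13 (Rmx q (z * w) b2 c2) *m leg23 (Rmx q w b3 c3)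
  = leg23 (Rmx q w b3 c3) *m leg13 (Rmx q (z * w) b2 c2)
      *m leg12 (Rmx q z b1 c1).
Proof. by apply: Rmx_yang_baxter; rewrite unitfE pnatr_eq0. Qed.
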